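(* Let $n\in\mathbb{N}$, $h>1$, $\alpha,\beta>0$, $\mathcal{A}_0,\mathcal{A}_1\in\mathbb{R}^{n\times n}$, and let $Y_{h,\alpha,\beta}^{\mathcal{A}_0,\mathcal{A}_1}(t,s)$ be the delayed Mittag-Leffler type function with logarithm. Then the following hold. (i) If $\mathcal{A}_0=\Theta$, then for $k\in\mathbb{N}\cup\{0\}$ and $h^{k-1}<\frac{t}{h}\leq h^{k}$ with $t>1$, $$Y_{h,\alpha,\beta}^{\mathcal{A}_0,\mathcal{A}_1}(t,1)=E_{h,\alpha,\beta}^{\mathcal{A}_1}\left(\ln\frac{t}{h}\right).$$ (ii) If $\mathcal{A}_1=\Theta$, then for $t>s>0$, $$Y_{h,\alpha,\beta}^{\mathcal{A}_0,\mathcal{A}_1}(t,s)=e_{\alpha,\beta}\left(\mathcal{A}_0;\ln\frac{t}{s}\right)=\left(\ln\frac{t}{s}\right)^{\beta-1}\sum_{m=0}^\infty\frac{\mathcal{A}_0^m\left(\ln\frac ts\right)^{\alpha m}}{\Gamma(m\alpha+\beta)}.$$ (iii) If $\alpha=\beta=1$ and $\mathcal{A}_0\mathcal{A}_1=\mathcal{A}_1\mathcal{A}_0$, then for $s>0$, $k\in\mathbb{N}\cup\{0\}$ and $sh^{k}<t\leq sh^{k+1}$, $$Y_{h,1,1}^{\mathcal{A}_0,\mathcal{A}_1}(t,s)=e^{\mathcal{A}_0(\ln t-\ln s)}\,e_{h}^{\mathcal{A}_{11}(\ln t-\ln (sh))},\qquad \mathcal{A}_{11}=\mathcal{A}_1e^{-\mathcal{A}_0\ln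 h}.$$
   Context: $\Theta$ is the zero matrix and $I$ the identity matrix. For $\alpha,\beta>0$, a square matrix $\mathcal{A}_0$ and $x>0$, put $$e_{\alpha,\beta}(\mathcal{A}_0;x)=x^{\beta-1}\sum_{m=0}^{\infty}\frac{\mathcal{A}_0^{m}x^{\alpha m}}{\Gamma(m\alpha+\beta)}.$$ For $s>0$ define recursively $Y_{\alpha,\beta,0}(t,s)=e_{\alpha,\beta}(\mathcal{A}_0;\ln\frac{t}{s})$ for $t>s$, and for $k\ge1$, $t>sh^k$, $$Y_{\alpha,\beta,k}(t,sh^{k})=\int_{sh^{k}}^{t}e_{\alpha,\alpha}\left(\mathcal{A}_{0};\ln\frac{t}{r}\right)\mathcal{A}_{1}\,Y_{\alpha,\beta,k-1}\left(\frac{r}{h},sh^{k-1}\right)\frac{dr}{r}.$$ The delayed Mittag-Leffler type function with logarithm generated by $\mathcal{A}_0,\mathcal{A}_1$ is $$Y_{h,\alpha,\beta}^{\mathcal{A}_0,\mathcal{A}_1}(t,s)=\begin{cases}\Theta,& t<s,\\ I,& t=s,\\ \sum_{j=0}^{k}Y_{\alpha,\beta,j}(t,sh^{j}),& sh^{k}<t\le sh^{k+1},\ k=0,1,2,\dots\end{cases}$$ The two-parameter delayed Mittag-Leffler type matrix function with logarithm is $$E_{h,\alpha,\beta}^{\mathcal{A}_1}(\ln t)=\begin{cases}\Theta,& 0<t\le \frac1h,\\ \sum_{j=0}^{p}\mathcal{A}_1^{j}\dfrac{(\ln t-(j-1)\ln h)^{j\alpha+\beta-1}}{\Gamma(j\alpha+\beta)},&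 h^{p-1}<t\le h^{p},\ p=0,1,2,\dots\end{cases}$$ The delayed exponential is, for a square matrix $B$ and $x>-\ln h$ with $(p-1)\ln h<x\le p\ln h$, $p=0,1,2,\dots$, $$e_h^{Bx}=\sum_{j=0}^{p}B^{j}\frac{(x-(j-1)\ln h)^{j}}{j!}$$ (that is, $e_h^{B\ln t}=E^{B}_{h,1,1}(\ln t)$). *)

(* Defs.v *)
From HB Require Import structures.
From mathcomp Require Import all_boot all_order all_algebra.
From mathcomp Require Import all_classical all_reals all_analysis.

Set Implicit Arguments.
Unset Strict Implicit.
Unset Printing Implicit Defensive.

Import Order.TTheory GRing.Theory Num.Theory.
Import numFieldNormedType.Exports.

Local Open Scope classical_set_scope.
Local Open Scope ring_scope.

Definition Gamma {R : realType} (x : R) : R :=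
  \int[lebesgue_measure]_(u in `[0, +oo[) (u `^ (x - 1) * expR (- u)).

(* Matrix series are limits in the norm topology of 'M[R]_n. *)
Definition expmx {R : realType} {n : nat} (M : 'M[R]_n) : 'M[R]_n :=
  limn (series (fun m : nat => (m`!%:R)^-1 *: M ^+ m)).

(* e_{alpha,beta}(A; x), meant for x > 0. *)
Definition mittag_leffler {R : realType} {n : nat} (alpha beta : R)
    (A : 'M[R]_n) (x : R) : 'M[R]_n :=
  x `^ (beta - 1) *:
    limn (series (fun m : nat =>
      (x `^ (alpha * m%:R) / Gamma (m%:R * alpha + beta)) *: A ^+ m)).

(* Entrywise Lebesgue integral: the integrands below may be unbounded (yet
   integrable) at the endpoints when alpha < 1 or beta < 1. *)
Definition integralmx {R : realType} {n : nat} (D : set R)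
    (F : R -> 'M[R]_n) : 'M[R]_n :=
  \matrix_(i, j) \int[lebesgue_measure]_(r in D) (F r i j).

(* The second argument of Y_{alpha,beta,k} is taken to be the whole quantity
   s h^k, here called sigma; thus s h^(k-1) is sigma / h. *)
Fixpoint delayedML_term {R : realType} {n : nat} (h alpha beta : R)
    (A0 A1 : 'M[R]_n) (k : nat) (t sigma : R) : 'M[R]_n :=
  if k is k'.+1 then
    integralmx `[sigma, t] (fun r =>
      r^-1 *: (mittag_leffler alpha alpha A0 (ln (t / r)) *m A1 *m
               delayedML_term h alpha beta A0 A1 k' (r / h) (sigma / h)))
  else mittag_leffler alpha beta A0 (ln (t / sigma)).

(* For h > 1 and t > s > 0 the set below is a singleton. *)
Definition delay_index {R : realType} (h t s : R) : nat :=
  xget 0%N [set k : nat | s * h ^+ k < t <= s * h ^+ k.+1].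

(* Y_{h,alpha,beta}^{A0,A1}(t, s) *)
Definition delayedML {R : realType} {n : nat} (h alpha beta : R)
    (A0 A1 : 'M[R]_n) (t s : R) : 'M[R]_n :=
  if t < s then 0
  else if t == s then 1%:M
  else \sum_(j < (delay_index h t s).+1)
         delayedML_term h alpha beta A0 A1 j t (s * h ^+ j).

(* E_{h,alpha,beta}^A(x) with x = ln t: the conditions on t > 0 are conditions
   on expR x.  The set of p's is a singleton when h > 1 and expR x > h^-1. *)
Definition delayedML2 {R : realType} {n : nat} (h alpha beta : R)
    (A : 'M[R]_n) (x : R) : 'M[R]_n :=
  if expR x <= h^-1 then 0
  else
    let p := xget 0%N [set p : nat | h ^ (p%:Z - 1) < expR x <= h ^+ p] in
    \sum_(j < p.+1)
      ((x - (j%:R - 1) * ln h) `^ (j%:R * alpha + beta - 1)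
         / Gamma (j%:R * alpha + beta)) *: A ^+ j.

(* e_h^{B x}.  It is only specified for x > - ln h; the value 0 elsewhere agrees
   with delayedML2 h 1 1 B x. *)
Definition delayed_exp {R : realType} {n : nat} (h : R) (B : 'M[R]_n) (x : R) :
    'M[R]_n :=
  if x <= - ln h then 0
  else
    let p := xget 0%N
      [set p : nat | (p%:R - 1) * ln h < x <= p%:R * ln h] in
    \sum_(j < p.+1) ((x - (j%:R - 1) * ln h) ^+ j / j`!%:R) *: B ^+ j.

(* Main.v *)
(** The proof rests on the Beta-Gamma identity in logarithmic coordinates,
    int_sigma^t ln(t/r)^(a-1) ln(r/sigma)^(b-1) dr/r
      = Gamma(a) Gamma(b) / Gamma(a+b) * ln(t/sigma)^(a+b-1).
    By induction on k it gives Y_k(t, sigma) =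
    A1^k ln(t/sigma)^(k alpha + beta - 1) / Gamma(k alpha + beta) when A0 = 0.
    When alpha = beta = 1 and A0, A1 commute, the two exponentials
    e^(A0 ln(t/r)) and e^(A0 ln(r/sigma)) under the integral merge into
    e^(A0 ln(t/sigma)), and the same identity with a = 1 gives
    Y_k(t, sigma) = A1^k e^(A0 ln(t/sigma)) ln(t/sigma)^k / k!.

    For the Beta-Gamma identity let k_a(x) = x^(a-1) for x > 0 and 0 elsewhere.
    By scaling, the convolution k_a * k_b is B(a,b) k_(a+b); integrating it
    against e^(-w) and applying Tonelli yields Gamma(a) Gamma(b) =
    B(a,b) Gamma(a+b), as an identity between extended reals.

    The law e^(X+Y) = e^X e^Y for commuting matrices holds because the remainder
    of the truncated Cauchy product is dominated by the corresponding remainder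
    for the real exponential series at n|X| and n|Y|. *)
Require Import Defs.
From HB Require Import structures.
From mathcomp Require Import all_boot all_order all_algebra.
From mathcomp Require Import all_classical all_reals all_analysis.
From mathcomp Require Import measurable_realfun ring lra.

Set Implicit Arguments.
Unset Strict Implicit.
Unset Printing Implicit Defensive.

Import Order.TTheory GRing.Theory Num.Theory.
Import numFieldNormedType.Exports.

Local Open Scope classical_set_scope.
Local Open Scope ring_scope.

(** * Affine substitution, power kernels and the product of two Gamma integrals *)

(** The image of Lebesgue measure under x -> c x + d, scaled by c, gives each interval ]a, b] its
    length, so it is Lebesgue measure by uniqueness. *)
Lemma ge0_integral_affine (R : realType) (f : R -> \bar R) (c d : R) :
  0 < c -> measurable_fun [set: R] f -> (forall x, 0 <= f x)%E ->
  (\int[lebesgue_measure]_x f x =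
   c%:E * \int[lebesgue_measure]_x f (c * x + d)%R)%E.
Proof.
move=> c0 mf f0.
pose phi : measurableTypeR R -> measurableTypeR R := fun x => c * x + d.
have mphi : measurable_fun setT phi.
  by apply: measurable_funD => //; apply: measurable_funM.
have -> : (\int[lebesgue_measure]_x f (c * x + d)%R =
    \int[pushforward lebesgue_measure phi]_x f x)%E.
  by rewrite ge0_integral_pushforward.
pose k : {nonneg R} := NngNum (ltW c0).
rewrite -[c]/(k%:num) -ge0_integral_mscale//.
apply: eq_measure_integral => A mA _.
pose m : {measure set (measurableTypeR R) -> \bar R} :=
  mscale k (pushforward (@lebesgue_measure R) phi).
apply: (@lebesgue_measure_unique R (m mphi)) => //= _ [[a b] _ <-].
rewrite /m /mscale /= /pushforward.
have -> : phi @^-1` `]a, b] = `](a - d) / c, (b - d) / c]%classic.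
  apply/seteqP; split => x /=; rewrite /phi !in_itv/= ltr_pdivrMr// ler_pdivlMr//;
  by rewrite (mulrC x) ltrBlDr lerBrDr.
rewrite !lebesgue_measure_itv /= !lte_fin ltr_pM2r ?invr_gt0//.
rewrite ltrD2r; case: ifPn => _; last by rewrite mule0.
by rewrite -EFinD -EFinM; congr EFin; field; rewrite gt_eqF.
Qed.

(** Extending the power by 0 turns the Beta and Gamma integrals into integrals over the whole line,
    where shifts and scalings apply directly. *)
Definition power_kernel {R : realType} (a x : R) : R :=
  if 0 < x then x `^ (a - 1) else 0.

Lemma power_kernel_ge0 (R : realType) (a x : R) : 0 <= power_kernel a x.
Proof. by rewrite /power_kernel; case: ifP => // _; exact: powR_ge0. Qed.

Lemma measurable_power_kernel (R : realType) (a : R) :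
  measurable_fun [set: R] (power_kernel a).
Proof.
apply: measurable_fun_ifT => //; exact: measurable_fun_ltr.
Qed.

Lemma power_kernelM (R : realType) (a c x : R) : 0 < c ->
  power_kernel a (c * x) = c `^ (a - 1) * power_kernel a x.
Proof.
move=> c0; rewrite /power_kernel pmulr_rgt0//; case: ifP => x0.
  by rewrite powRM// ltW.
by rewrite mulr0.
Qed.

Lemma power_kernel_le0 (R : realType) (a x : R) :
  x <= 0 -> power_kernel a x = 0.
Proof. by rewrite /power_kernel ltNge => ->. Qed.

Lemma power_kernel_gt0 (R : realType) (a x : R) :
  0 < x -> power_kernel a x = x `^ (a - 1).
Proof. by rewrite /power_kernel => ->. Qed.

Lemma powRD_gt0 (R : realType) (x r s : R) :
  0 < x -> x `^ (r + s) = x `^ r * x `^ s.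
Proof. by move=> x0; rewrite powRD// (gt_eqF x0) implybT. Qed.

Lemma measurable_power_kernel_conv (R : realType) (a b w : R) :
  measurable_fun [set: R]
    (fun x => (power_kernel a (w - x) * power_kernel b x)%:E).
Proof.
apply/measurable_EFinP/measurable_funM; last exact: measurable_power_kernel.
apply: measurableT_comp; first exact: measurable_power_kernel.
exact: measurable_funB.
Qed.

Lemma power_kernel_conv_ge0 (R : realType) (a b w x : R) :
  0 <= power_kernel a (w - x) * power_kernel b x.
Proof. by rewrite mulr_ge0 ?power_kernel_ge0. Qed.

(* B(a, b) and Gamma(a) in the extended reals, so that Tonelli's theorem applies
   before either of them is known to be finite. *)
Definition ebeta {R : realType} (a b : R) : \bar R :=
  (\int[lebesgue_measure]_x (power_kernel a (1 - x) * power_kernel b x)%:E)%E.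

Definition egamma {R : realType} (a : R) : \bar R :=
  (\int[lebesgue_measure]_x (power_kernel a x * expR (- x))%:E)%E.

(** For w <= 0 one factor vanishes at every x. For w > 0 the substitution x -> w x yields w^(a-1)
    w^(b-1), and its Jacobian w completes the exponent to a + b - 1. *)
Lemma power_kernel_convolution (R : realType) (a b w : R) :
  (\int[lebesgue_measure]_x (power_kernel a (w - x) * power_kernel b x)%:E =
   (power_kernel (a + b) w)%:E * ebeta a b)%E.
Proof.
have [w0|w0] := ltP 0 w; last first.
  rewrite (power_kernel_le0 _ w0) mul0e; apply: integral0_eq => x _.
  have [x0|x0] := leP x 0; first by rewrite (power_kernel_le0 _ x0) mulr0.
  by rewrite power_kernel_le0 ?mul0r// subr_le0 (le_trans w0)// ltW.
rewrite (ge0_integral_affine 0 w0); last 2 first.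
- exact: measurable_power_kernel_conv.
- by move=> x; rewrite lee_fin power_kernel_conv_ge0.
under eq_integral => x _.
  rewrite addr0 -{1}[w]mulr1 -mulrBr (power_kernelM _ _ w0).
  rewrite (power_kernelM _ _ w0) mulrACA EFinM.
  over.
rewrite ge0_integralZl_EFin//; last 3 first.
- by move=> x _; rewrite lee_fin power_kernel_conv_ge0.
- exact: measurable_power_kernel_conv.
- by rewrite mulr_ge0 ?powR_ge0.
rewrite muleA -EFinM power_kernel_gt0// -{1}(powRr1 (ltW w0)) -!powRD_gt0//.
by rewrite (_ : 1 + _ = a + b - 1)//; ring.
Qed.

Lemma measurable_gamma_integrand (R : realType) (a : R) :
  measurable_fun [set: R] (fun x => (power_kernel a x * expR (- x))%:E).
Proof.
apply/measurable_EFinP/measurable_funM; first exact: measurable_power_kernel.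
by apply: measurableT_comp => //; exact: measurable_expR.
Qed.

Lemma gamma_integrand_ge0 (R : realType) (a x : R) :
  0 <= power_kernel a x * expR (- x).
Proof. by rewrite mulr_ge0 ?power_kernel_ge0 ?expR_ge0. Qed.

Lemma egamma_ge0 (R : realType) (a : R) : (0 <= egamma a)%E.
Proof.
by apply: integral_ge0 => x _; rewrite lee_fin gamma_integrand_ge0.
Qed.

Lemma ebeta_ge0 (R : realType) (a b : R) : (0 <= ebeta a b)%E.
Proof.
by apply: integral_ge0 => x _; rewrite lee_fin mulr_ge0 ?power_kernel_ge0.
Qed.

Lemma egammaM (R : realType) (a b : R) :
  (egamma a * egamma b = ebeta a b * egamma (a + b))%E.
Proof.
pose F (p : R * R) : \bar R := (power_kernel a (p.1 - p.2) *
  power_kernel b p.2 * expR (- p.1))%:E.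
have F_ge0 p : (0 <= F p)%E.
  by rewrite lee_fin !mulr_ge0 ?power_kernel_ge0 ?expR_ge0.
have mF : measurable_fun [set: R * R] F.
  apply/measurable_EFinP/measurable_funM; first apply: measurable_funM.
  - apply: measurableT_comp; first exact: measurable_power_kernel.
    exact: measurable_funB.
  - by apply: measurableT_comp => //; exact: measurable_power_kernel.
  - apply: measurableT_comp; first exact: measurable_expR.
    exact: measurableT_comp.
(* The first variable of [F] is the sum of the two Gamma variables: for fixed y, a shift by y makes
   the inner integral [egamma a] times the integrand of [egamma b] at y. *)
transitivity (\int[lebesgue_measure]_y \int[lebesgue_measure]_x F (x, y))%E.
  rewrite -ge0_integralZl//=.
  - apply: eq_integral => y _.
    rewrite [egamma a](@ge0_integral_affine _ _ 1 (- y))//; last 2 first.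
    + exact: measurable_gamma_integrand.
    + by move=> x; rewrite lee_fin gamma_integrand_ge0.
    rewrite mul1e muleC -ge0_integralZl//=.
    + apply: eq_integral => x _; rewrite -EFinM; congr EFin.
      rewrite mul1r opprB expRB expRN.
      rewrite expRN /=; field.
      by rewrite !gt_eqF ?expR_gt0.
    + apply: (measurableT_comp (measurable_gamma_integrand a)).
      by apply: measurable_funB => //; exact: measurable_funM.
    + by move=> x _; rewrite lee_fin gamma_integrand_ge0.
    + by rewrite lee_fin gamma_integrand_ge0.
  - exact: measurable_gamma_integrand.
  - by move=> y _; rewrite lee_fin gamma_integrand_ge0.
  - exact: egamma_ge0.
(* Integrating over y first, for fixed x, exposes the convolution of the two kernels. *)
rewrite -(@fubini_tonelli _ _ _ _ _ lebesgue_measure lebesgue_measure F)//.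
rewrite -ge0_integralZl//=.
- apply: eq_integral => x _.
  under eq_integral => y _ do rewrite /F /= mulrC EFinM.
  rewrite ge0_integralZl_EFin ?expR_ge0//=.
  + by rewrite power_kernel_convolution EFinM muleC [RHS]muleCA muleA.
  + by move=> y _; rewrite lee_fin power_kernel_conv_ge0.
  + exact: measurable_power_kernel_conv.
- exact: measurable_gamma_integrand.
- by move=> x _; rewrite lee_fin gamma_integrand_ge0.
- exact: ebeta_ge0.
Qed.

(** * Increasing substitution on open intervals *)

(* Unlike [integration_by_substitution_increasing], this allows G and the
   derivative of F to be unbounded at the endpoints; the proof exhausts the open
   intervals by compact ones. *)
Lemma ge0_integration_by_substitution_oo (R : realType) (F G : R -> R)
    (a b : R) : a < b ->
  {in `[a, b] &, {homo F : x y / x < y}} ->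
  {in `]a, b[, continuous F^`()%classic} ->
  derivable_oo_LRcontinuous F a b ->
  {in `]F a, F b[, continuous G} ->
  {in `]F a, F b[, forall y, 0 <= G y} ->
  (\int[lebesgue_measure]_(y in `]F a, F b[) (G y)%:E =
   \int[lebesgue_measure]_(x in `]a, b[) (G (F x) * F^`()%classic x)%:E)%E.
Proof.
move=> ab incF cF' [dF Fa Fb] cG G0.
have cF x : x \in `]a, b[ -> {for x, continuous F}.
  by move=> xab; apply/differentiable_continuous/derivable1_diffP/dF.
have leF : {in `[a, b] &, {homo F : x y / x <= y}} by exact: ltW_homo_in.
(* Since [harmonic 0] is 1, [u 0] and [v 0] are both the midpoint; the compact intervals
   [[u n, v n]] are therefore never empty. *)
pose d := (b - a) / 2; have d0 : 0 < d by rewrite divr_gt0// subr_gt0.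
pose u n := a + d * harmonic n; pose v n := b - d * harmonic n.
have hn n : 0 < (@harmonic R n) by exact: harmonic_gt0.
have h1 n : (@harmonic R n) <= 1 by rewrite /= invf_le1// ler1n.
have dh n : 0 < d * harmonic n <= d.
  by rewrite mulr_gt0 ?hn// ler_piMr ?h1// ltW.
have [au uv vb] : [/\ forall n, a < u n, forall n, u n <= v n & forall n, v n < b].
  by split=> n; rewrite /u /v; have /andP[] := dh n; rewrite /d; lra.
have uoo n : u n \in `]a, b[ by rewrite in_itv/= au (le_lt_trans (uv n)).
have voo n : v n \in `]a, b[ by rewrite in_itv/= vb (lt_le_trans (au n)).
have ucc n : u n \in `[a, b] by exact: subset_itv_oo_cc (uoo n).
have vcc n : v n \in `[a, b] by exact: subset_itv_oo_cc (voo n).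
have acc : a \in `[a, b] by rewrite in_itv/= lexx ltW.
have bcc : b \in `[a, b] by rewrite in_itv/= lexx ltW.
have cvgu : u n @[n --> \oo] --> a.
  rewrite -[X in _ --> X]addr0 -[X in _ + X](mulr0 d).
  by apply: cvgD; [exact: cvg_cst|apply: cvgM; [exact: cvg_cst|exact: cvg_harmonic]].
have cvgv : v n @[n --> \oo] --> b.
  rewrite -[X in _ --> X]subr0 -[X in _ - X](mulr0 d).
  by apply: cvgB; [exact: cvg_cst|apply: cvgM; [exact: cvg_cst|exact: cvg_harmonic]].
have leu n m : (n <= m)%N -> u m <= u n.
  by move=> nm; rewrite lerD2l ler_pM2l// lef_pV2 ?posrE// ler_nat.
have lev n m : (n <= m)%N -> v n <= v m.
  by move=> nm; rewrite lerD2l lerN2 ler_pM2l// lef_pV2 ?posrE// ler_nat.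
have cvgFu : F (u n) @[n --> \oo] --> F a by exact: ((cvg_at_rightP _ _ _).1 Fa u).
have cvgFv : F (v n) @[n --> \oo] --> F b by exact: ((cvg_at_leftP _ _ _).1 Fb v).
have UI : \bigcup_n `[u n, v n]%classic = `]a, b[%classic.
  apply/seteqP; split=> [x [n _]|x]/=.
    by rewrite !in_itv/= => /andP[ux xv]; rewrite (lt_le_trans (au n))// (le_lt_trans xv).
  rewrite in_itv/= => /andP[ax xb].
  have [n [ux xv]] : exists n, u n < x /\ x < v n.
    apply: (@filter_ex _ \oo); near=> n; split; near: n.
      exact: cvgr_lt cvgu _ ax.
    exact: cvgr_gt cvgv _ xb.
  by exists n => //=; rewrite in_itv/= !ltW.
have UJ : \bigcup_n `[F (u n), F (v n)]%classic = `]F a, F b[%classic.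
  apply/seteqP; split=> [x [n _]|x]/=.
    rewrite !in_itv/= => /andP[ux xv].
    by rewrite (lt_le_trans _ ux) ?incF// (le_lt_trans xv)// incF.
  rewrite in_itv/= => /andP[ax xb].
  have [n [ux xv]] : exists n, F (u n) < x /\ x < F (v n).
    apply: (@filter_ex _ \oo); near=> n; split; near: n.
      exact: cvgr_lt cvgFu _ ax.
    exact: cvgr_gt cvgFv _ xb.
  by exists n => //=; rewrite in_itv/= !ltW.
have subI n : `[u n, v n]%classic `<=` `]a, b[%classic.
  by rewrite -UI; move=> x ?; exists n.
have subJ n : `[F (u n), F (v n)]%classic `<=` `]F a, F b[%classic.
  by rewrite -UJ; move=> x ?; exists n.
have FJ x : x \in `]a, b[ -> F x \in `]F a, F b[.
  move=> xab; have xcc : x \in `[a, b] by exact: subset_itv_oo_cc xab.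
  by move: xab; rewrite !in_itv/= => /andP[ax xb]; rewrite !incF.
have F'0 x : x \in `]a, b[ -> 0 <= F^`()%classic x.
  have oab : (`]a, b[%classic : set R)° = `]a, b[%classic.
    by apply/interior_id; exact: interval_open.
  move=> xab; apply: (@incr_derive1_ge0 _ F `]a, b[%classic).
  - by rewrite oab => y; rewrite inE; exact: dF.
  - by move=> y z; rewrite !inE => ya za; apply: incF; exact: subset_itv_oo_cc.
  - by rewrite oab.
(* Both sides are limits of one sequence: monotone exhaustion in y first, then the same integrals
   rewritten over compact intervals in x. *)
rewrite -UI -UJ; apply: (@cvg_unique _ _
  ((\int[lebesgue_measure]_(y in `[F (u n), F (v n)]) (G y)%:E)%E @[n --> \oo])) => //.
  apply: ge0_nondecreasing_set_cvg_integral.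
  - by move=> n m nm; rewrite subsetEset; apply: subset_itv; rewrite bnd_simp leF// ?leu ?lev.
  - by move=> n; exact: measurable_itv.
  - move=> n; apply/measurable_EFinP.
    apply: measurable_funS (subJ n) _ => //.
    apply: open_continuous_measurable_fun; first exact: interval_open.
    by move=> y; rewrite inE; exact: cG.
  - by move=> n y /subJ; rewrite lee_fin; exact: G0.
have -> : (fun n => \int[lebesgue_measure]_(y in `[F (u n), F (v n)]) (G y)%:E)%E =
    (fun n => \int[lebesgue_measure]_(x in `[u n, v n]) (G (F x) * F^`()%classic x)%:E)%E.
  apply/funext => n.
  have sub : {subset `[u n, v n] <= `]a, b[} by move=> x; exact: subI.
  rewrite (@integration_by_substitution_increasing _ F G _ _ (uv n)).
  - by [].
  - by move=> x y /sub /subset_itv_oo_cc xab /sub /subset_itv_oo_cc yab; exact: incF.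
  - by move=> x /subset_itv_oo_cc /sub; exact: cF'.
  - by apply: cvgP; apply: cvg_at_right_filter; exact: cF'.
  - by apply: cvgP; apply: cvg_at_left_filter; exact: cF'.
  - split.
    + by move=> x /subset_itv_oo_cc /sub; exact: dF.
    + by apply: cvg_at_right_filter; exact: cF.
    + by apply: cvg_at_left_filter; exact: cF.
  - by apply: continuous_in_subspaceT => y; rewrite inE => /subJ; exact: cG.
apply: ge0_nondecreasing_set_cvg_integral.
- by move=> n m nm; rewrite subsetEset; apply: subset_itv; rewrite bnd_simp ?leu ?lev.
- by move=> n; exact: measurable_itv.
- move=> n; apply/measurable_EFinP.
  apply: measurable_funS (subI n) _ => //.
  apply: open_continuous_measurable_fun; first exact: interval_open.
  move=> x; rewrite inE => xab; apply: cvgM; last exact: cF'.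
  by apply: continuous_comp; [exact: cF|apply: cG; exact: FJ].
- by move=> n x /subI xab; rewrite lee_fin mulr_ge0 ?F'0 ?G0 ?FJ.
Unshelve. all: by end_near. Qed.

(** * The Gamma function: finiteness, positivity and recurrence *)

(** On [0, +oo[ the two integrands can differ only at 0, which is a null set. *)
Lemma egammaE (R : realType) (a : R) :
  (egamma a =
   \int[lebesgue_measure]_(x in `[0%R, +oo[) (x `^ (a - 1) * expR (- x))%:E)%E.
Proof.
rewrite -integral_itv_obnd_cbnd.
  rewrite [RHS]integral_mkcond; apply: eq_integral => x _.
  rewrite patchE mem_setE in_itv/= andbT /power_kernel.
  by case: ifP => //; rewrite mul0r.
apply: measurable_funTS; apply/measurable_EFinP/measurable_funM.
  exact: measurable_powR.
by apply: measurableT_comp => //; exact: measurable_expR.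
Qed.

Lemma egamma1 (R : realType) : egamma (1 : R) = 1%E.
Proof.
rewrite -(@integral_exponential_pdf R 1 ltr01) egammaE integral_mkcond.
apply: eq_integral => x _.
rewrite /exponential_pdf !patchE; case: ifP => // _.
by rewrite subrr powRr0 !mul1r mulN1r.
Qed.

Lemma continuous_powR (R : realType) (c x : R) : 0 < x ->
  {for x, continuous (@powR R ^~ c)}.
Proof.
move=> x0; apply/differentiable_continuous/derivable1_diffP/derivable_powR.
by rewrite in_itv/= x0.
Qed.

Lemma continuous_eq_in_open (R : realType) (f g : R -> R) (a b x : R) :
  {in `]a, b[, f =1 g} -> x \in `]a, b[ -> {for x, continuous g} ->
  {for x, continuous f}.
Proof.
move=> fg xab; rewrite /prop_for /continuous_at fg//; apply: cvg_trans.
by apply: near_eq_cvg; near=> y; apply/esym/fg; near: y; exact: near_in_itvoo.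
Unshelve. all: by end_near. Qed.

(** The substitution y = x^b turns x^(b-1) dx into dy / b. For b < 1 the derivative blows up at 0,
    hence the substitution on open intervals. *)
Lemma ebeta1 (R : realType) (b : R) : 0 < b -> ebeta 1 b = (b^-1)%:E.
Proof.
move=> b0; have pb0 : (0 : R) `^ b = 0 by rewrite powR0 ?gt_eqF.
have pb1 : (1 : R) `^ b = 1 by rewrite powR1.
have xy (x : R) : x \in `]0, 1[ -> x \in `]0, +oo[ by rewrite !in_itv/= => /andP[->].
have dF : {in `]0, 1[, (@powR R ^~ b)^`()%classic =1 (fun x : R => b * x `^ (b - 1))}.
  by move=> x /xy; exact: powR_derive1.
transitivity (\int[lebesgue_measure]_(x in `](0 `^ b)%R, (1 `^ b)%R[)
    (cst b^-1 x)%:E)%E; last first.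
  transitivity (b^-1%:E * lebesgue_measure (`]0%R, 1%R[%classic : set R))%E.
    by rewrite pb0 pb1 -integral_cst.
  by rewrite lebesgue_measure_itv/= lte01 oppr0 adde0 mule1.
rewrite (@ge0_integration_by_substitution_oo _ (@powR R ^~ b) (cst b^-1) 0 1).
- rewrite [RHS]integral_mkcond; apply: eq_integral => x _.
  rewrite patchE mem_setE in_itv/=; case: ifPn => [x01|].
    have /andP[x0 x1] := x01.
    by rewrite dF ?in_itv//= !power_kernel_gt0 ?subr_gt0// subrr powRr0 mul1r mulKf ?gt_eqF.
  rewrite negb_and -!leNgt => /orP[x0|x1]; first by rewrite (power_kernel_le0 _ x0) mulr0.
  by rewrite power_kernel_le0 ?mul0r// subr_le0.
- by [].
- by move=> x y; rewrite !in_itv/= => /andP[x0 _] /andP[y0 _]; apply: gt0_ltr_powR.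
- move=> x x01; apply: (continuous_eq_in_open dF x01).
  apply: cvgM; first exact: cvg_cst.
  by apply: continuous_powR; move: x01; rewrite in_itv/= => /andP[].
- split.
  + by move=> x /xy; exact: derivable_powR.
  + by rewrite pb0; exact: powR_cvg0.
  + exact/cvg_at_left_filter/continuous_powR.
- by move=> y _; exact: cvg_cst.
- by move=> y _; rewrite /= invr_ge0 ltW.
Qed.

(** On ]0, 1[ the integrand is at least e^(-1) x^(a-1), whose integral there is e^(-1) / a. *)
Lemma egamma_gt0 (R : realType) (a : R) : 0 < a -> (0 < egamma a)%E.
Proof.
move=> a0; apply: (@lt_le_trans _ _ ((expR (-1))%:E * ebeta 1 a)%E).
  by rewrite ebeta1// mule_gt0// lte_fin ?expR_gt0 ?invr_gt0.
rewrite /ebeta -ge0_integralZl_EFin ?expR_ge0//=.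
- apply: ge0_le_integral => //=.
  + by move=> x _; rewrite lee_fin mulr_ge0 ?expR_ge0 ?power_kernel_conv_ge0.
  + apply: measurable_funeM; exact: measurable_power_kernel_conv.
  + exact: measurable_gamma_integrand.
  + move=> x _; rewrite -EFinM lee_fin.
    have [x1|x1] := leP 1 x.
      by rewrite power_kernel_le0 ?subr_le0// mul0r mulr0 gamma_integrand_ge0.
    rewrite (@power_kernel_gt0 _ 1) ?subr_gt0// subrr powRr0 mul1r mulrC.
    by rewrite ler_wpM2l ?power_kernel_ge0// ler_expR lerN2 ltW.
- by move=> x _; rewrite lee_fin power_kernel_conv_ge0.
- exact: measurable_power_kernel_conv.
Qed.

(** For x >= 1, x^c is at most x^m with an integer m >= |c|, and (x/2)^m / m! <= e^(x/2). Half of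
    the decay of e^(-x) is left for integrability. *)
Lemma powR_le_expR_half (R : realType) (c : R) :
  exists2 C : R, 0 <= C & forall x : R, 1 <= x -> x `^ c <= C * expR (x / 2).
Proof.
pose m := (Num.Def.archi_bound `|c|).+1.
exists (2 ^+ m * m`!%:R); first by rewrite mulr_ge0 ?exprn_ge0.
move=> x x1; have x0 : 0 <= x / 2 by rewrite divr_ge0// (le_trans ler01).
apply: (@le_trans _ _ (x `^ m%:R)).
  apply: ler_powR => //; rewrite (le_trans (ler_norm _))//.
  by rewrite ltW// (lt_le_trans (archi_boundP (normr_ge0 c)))// ler_nat.
have := @expR_ge1Dxn _ _ m.-1 x0; rewrite -/m => expm.
rewrite powR_mulrn ?(le_trans ler01)// -[x in leLHS](divfK (_ : 2 != 0)) ?pnatr_eq0//.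
rewrite exprMn [leLHS]mulrC -mulrA ler_wpM2l ?exprn_ge0//.
rewrite [leRHS]mulrC -ler_pdivrMr ?ltr0n ?fact_gt0//.
by apply: (le_trans _ expm); rewrite lerDr.
Qed.

(** The dominating function has finite integral: [f] contributes [ebeta 1 a], that is 1 / a, and [g]
    contributes 2 C after rescaling by 2. *)
Lemma egamma_lty (R : realType) (a : R) : 0 < a -> (egamma a < +oo)%E.
Proof.
move=> a0; have [C C0 leC] := powR_le_expR_half (a - 1).
pose f (x : R) := (power_kernel 1 (1 - x) * power_kernel a x)%:E.
pose g (x : R) := (C * (power_kernel 1 x * expR (- (x / 2))))%:E.
have g0 x : (0 <= g x)%E.
  by rewrite lee_fin !mulr_ge0 ?expR_ge0 ?power_kernel_ge0.
have mg : measurable_fun [set: R] g.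
  apply/measurable_EFinP/measurable_funM; first exact: measurable_cst.
  apply: measurable_funM; first exact: measurable_power_kernel.
  apply: measurableT_comp; first exact: measurable_expR.
  by apply: measurableT_comp => //; exact: measurable_funM.
(* f bounds the integrand on ]0, 1[ and g bounds it on [1, +oo[ *)
apply: (@le_lt_trans _ _ (\int[lebesgue_measure]_x (f x + g x))%E).
  apply: ge0_le_integral => //=.
  + by move=> x _; rewrite lee_fin gamma_integrand_ge0.
  + exact: measurable_gamma_integrand.
  + by apply: emeasurable_funD => //; exact: measurable_power_kernel_conv.
  + move=> x _; rewrite /f /g -EFinD lee_fin.
    have [x0|x0] := leP x 0.
      by rewrite (power_kernel_le0 _ x0) mul0r (power_kernel_le0 _ x0) mul0r !mulr0 addr0.
    have [x1|x1] := leP 1 x.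
      rewrite [X in _ <= X + _](_ : _ = 0); last first.
        by rewrite power_kernel_le0 ?mul0r// subr_le0.
      rewrite add0r !power_kernel_gt0// subrr powRr0 mul1r.
      rewrite (le_trans (ler_wpM2r (expR_ge0 _) (leC _ x1)))//.
      by rewrite -mulrA -expRD ler_wpM2l// ler_expR; lra.
    rewrite (@power_kernel_gt0 _ 1 (1 - x)) ?subr_gt0// subrr powRr0 mul1r.
    apply: (@le_trans _ _ (power_kernel a x)).
      by rewrite ler_piMr ?power_kernel_ge0// expR_le1 oppr_le0 ltW.
    by rewrite lerDl -lee_fin; exact: g0.
rewrite ge0_integralD//; last 2 first.
- by move=> x _; rewrite lee_fin power_kernel_conv_ge0.
- exact: measurable_power_kernel_conv.
rewrite -/(ebeta 1 a) ebeta1// (ge0_integral_affine 0 (ltr0n _ 2) mg g0)//.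
under eq_integral => x _.
  rewrite /g addr0 power_kernelM// [2 * x]mulrC mulfK ?pnatr_eq0//.
  rewrite subrr powRr0 mul1r EFinM.
  over.
rewrite ge0_integralZl_EFin//; last 2 first.
- by move=> x _; rewrite lee_fin gamma_integrand_ge0.
- exact: measurable_gamma_integrand.
by rewrite -/(egamma 1) egamma1 mule1 -EFinM -EFinD ltry.
Qed.

Lemma egamma_Gamma (R : realType) (a : R) : 0 < a -> egamma a = (Gamma a)%:E.
Proof.
move=> a0; rewrite /Gamma /Rintegral -egammaE fineK// ge0_fin_numE ?egamma_ge0//.
exact: egamma_lty.
Qed.

Lemma Gamma_gt0 (R : realType) (a : R) : 0 < a -> 0 < Gamma a.
Proof. by move=> a0; rewrite -lte_fin -egamma_Gamma// egamma_gt0. Qed.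

Lemma ebeta_Gamma (R : realType) (a b : R) : 0 < a -> 0 < b ->
  ebeta a b = (Gamma a * Gamma b / Gamma (a + b))%:E.
Proof.
move=> a0 b0; have ab0 : 0 < a + b by rewrite addr_gt0.
have := egammaM a b; rewrite !egamma_Gamma// -EFinM.
(* An infinite B(a, b) is impossible: multiplied by Gamma(a + b) > 0 it stays infinite, whereas
   Gamma(a) Gamma(b) is finite. *)
have := ebeta_ge0 a b; case: (ebeta a b) => [r _|_|//]; last first.
  by rewrite gt0_mulye// lte_fin Gamma_gt0.
by rewrite -EFinM => -[->]; rewrite mulfK// gt_eqF// Gamma_gt0.
Qed.

Lemma Gamma1 (R : realType) : Gamma (1 : R) = 1.
Proof. by apply: EFin_inj; rewrite -egamma_Gamma// egamma1. Qed.

(** B(1, a) equals 1 / a by direct integration and Gamma(a) / Gamma(1 + a) by the Beta-Gamma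
    identity; comparing the two replaces integration by parts. *)
Lemma GammaS (R : realType) (a : R) : 0 < a -> Gamma (1 + a) = a * Gamma a.
Proof.
move=> a0; have := ebeta_Gamma ltr01 a0; rewrite ebeta1// Gamma1 mul1r => -[].
move=> /(congr1 GRing.inv); rewrite invf_div invrK => aG.
by rewrite [X in X * _]aG divfK// gt_eqF// Gamma_gt0.
Qed.

Lemma Gamma_nat (R : realType) (m : nat) : Gamma (m%:R + 1 : R) = m`!%:R.
Proof.
elim: m => [|m IH]; first by rewrite add0r Gamma1.
by rewrite addrC GammaS ?ltr0Sn// -natr1 IH natr1 factS natrM.
Qed.

(** * The Beta integral in logarithmic coordinates *)

(** With L = ln(t / sigma), the substitution x = ln(r / sigma) turns dr / r into dx and ln(t / r)
    into L - x, leaving a convolution of power kernels at L. The formula for [f] is asked only on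
    the open interval, as endpoints are null; [c] is meant to absorb matrix entries. *)
Lemma Rintegral_log_beta (R : realType) (sigma t a b c : R) (f : R -> R) :
  0 < sigma < t -> 0 < a -> 0 < b ->
  {in `]sigma, t[, forall r, f r =
    c * (ln (t / r) `^ (a - 1) * ln (r / sigma) `^ (b - 1) * r^-1)} ->
  \int[lebesgue_measure]_(r in `[sigma, t]) f r =
  c * (Gamma a * Gamma b / Gamma (a + b) * ln (t / sigma) `^ (a + b - 1)).
Proof.
move=> /andP[s0 st] a0 b0 fE; have t0 := lt_trans s0 st.
pose L := ln (t / sigma).
have L0 : 0 < L by rewrite ln_gt0// ltr_pdivlMr// mul1r.
pose g r := ln (t / r) `^ (a - 1) * ln (r / sigma) `^ (b - 1) * r^-1.
pose F r : R := ln r - ln sigma.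
pose G x : R := (L - x) `^ (a - 1) * x `^ (b - 1).
have gt0 r : r \in `]sigma, t[ -> 0 < r.
  by rewrite in_itv/= => /andP[sr _]; exact: lt_trans sr.
have FE (r : R) : 0 < r -> F r = ln (r / sigma) by move=> r0; rewrite ln_div.
have LFE (r : R) : 0 < r -> L - F r = ln (t / r).
  by move=> r0; rewrite /L !ln_div// /F; ring.
have dF (r : R) : 0 < r -> is_derive r (1 : R) F r^-1.
  move=> r0; rewrite -[r^-1]subr0; apply: is_deriveB.
  exact: is_derive1_ln.
have dF1 : {in `]sigma, t[, F^`()%classic =1 GRing.inv}.
  by move=> r /gt0 r0; rewrite derive1E; apply: derive_val; exact: dF.
have ig : (\int[lebesgue_measure]_(r in `]sigma, t[) (g r)%:E =
    (Gamma a * Gamma b / Gamma (a + b) * L `^ (a + b - 1))%:E)%E.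
  rewrite EFinM muleC -ebeta_Gamma// -(power_kernel_gt0 _ L0).
  rewrite -power_kernel_convolution.
  transitivity (\int[lebesgue_measure]_(x in `](F sigma), (F t)[) (G x)%:E)%E; last first.
    rewrite FE// FE// divff ?gt_eqF// ln1 integral_mkcond.
    apply: eq_integral => x _; rewrite patchE mem_setE in_itv/= -/L.
    case: ifPn => [/andP[x0 xL]|]; first by rewrite !power_kernel_gt0 ?subr_gt0.
    rewrite negb_and -!leNgt => /orP[x0|x1].
      by rewrite (power_kernel_le0 _ x0) mulr0.
    by rewrite power_kernel_le0 ?mul0r// subr_le0.
  rewrite (@ge0_integration_by_substitution_oo _ F G _ _ st).
  - apply: eq_integral => r; rewrite inE/= => rst; have r0 := gt0 _ rst.
    by rewrite dF1// /G LFE// FE.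
  - move=> x y; rewrite !in_itv/= => /andP[sx _] /andP[sy _] xy.
    by rewrite ltrD2r ltr_ln ?posrE// (lt_le_trans s0).
  - move=> r rst; apply: (continuous_eq_in_open dF1 rst).
    by apply: inv_continuous; rewrite gt_eqF// gt0.
  - have cF (r : R) : 0 < r -> {for r, continuous F}.
      by move=> r0; apply/differentiable_continuous/derivable1_diffP; have [] := dF r r0.
    split.
    + by move=> r /gt0 r0; have [] := dF r r0.
    + exact/cvg_at_right_filter/cF.
    + exact/cvg_at_left_filter/cF.
  - move=> x; rewrite FE// FE// divff ?gt_eqF// ln1 in_itv/= -/L => /andP[x0 xL].
    apply: cvgM; last exact: continuous_powR.
    apply: (@continuous_comp _ _ _ (fun y => L - y) (fun y => y `^ (a - 1))).
      by apply: cvgB; [exact: cvg_cst|exact: cvg_id].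
    by apply: continuous_powR; rewrite subr_gt0.
  - by move=> x _; rewrite mulr_ge0 ?powR_ge0.
have mg : measurable_fun `]sigma, t[ g.
  apply: (@eq_measurable_fun _ _ _ _ _ (fun r => G (F r) * r^-1)).
    by move=> r; rewrite inE/= => /gt0 r0; rewrite /G LFE// FE.
  apply: measurable_funM.
    have mF : measurable_fun [set: R] F.
      by apply: measurable_funB => //; exact: measurable_ln.
    apply: measurable_funTS; apply: (@measurableT_comp _ _ _ _ _ _ G) => //.
    apply: measurable_funM; last exact: measurable_powR.
    apply: (@measurableT_comp _ _ _ _ _ _ (@powR R ^~ (a - 1))).
      exact: measurable_powR.
    exact: measurable_funB.
  apply: open_continuous_measurable_fun; first exact: interval_open.
  by move=> r; rewrite inE => /gt0 r0; apply: inv_continuous; rewrite gt_eqF.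
have g0 r : 0 <= r -> 0 <= g r.
  by move=> r0; rewrite !mulr_ge0 ?powR_ge0 ?invr_ge0.
(* The finite value found in [ig] gives integrability, which allows [c], of either sign, to leave
   the integral. *)
have intg : lebesgue_measure.-integrable `]sigma, t[%classic (EFin \o g).
  apply/integrableP; split; first exact/measurable_EFinP.
  rewrite [X in (X < _)%E](_ : _ = \int[lebesgue_measure]_(r in `]sigma, t[) (g r)%:E)%E.
    by rewrite ig ltry.
  apply: eq_integral => r; rewrite inE/= => /gt0/ltW/g0 gr0.
  by rewrite ger0_norm.
have mf : measurable_fun `]sigma, t[ f.
  apply: (@eq_measurable_fun _ _ _ _ _ (fun r => c * g r)).
    by move=> r; rewrite inE/= => rst; rewrite fE.
  exact: measurable_funM.
transitivity (\int[lebesgue_measure]_(r in `]sigma, t[) (c * g r)).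
  rewrite /Rintegral integral_itv_bndoo; last exact/measurable_EFinP.
  by congr fine; apply: eq_integral => r; rewrite inE/= => rst; rewrite fE.
by rewrite RintegralZl// /Rintegral ig.
Qed.

(** * Truncated Cauchy products *)

(** Removing the triangle i + j < N from the square i, j < N leaves the pairs with i + j >= N. A
    general ring lets the matrix remainder be compared termwise with the real one. *)
Lemma cauchy_product_partial (S : pzRingType) (a b c : nat -> S) (N : nat) :
  (forall m, c m = \sum_(0 <= j < m.+1) a (m - j)%N * b j) ->
  (\sum_(0 <= i < N) a i) * (\sum_(0 <= j < N) b j) - \sum_(0 <= m < N) c m =
  \sum_(0 <= j < N) \sum_(N - j <= i < N) a i * b j.
Proof.
move=> cE.
have -> : \sum_(0 <= m < N) c m = \sum_(0 <= j < N) \sum_(0 <= i < N - j) a i * b j.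
  elim: N => [|N IH]; first by rewrite !big_nil.
  rewrite big_nat_recr//= IH cE [RHS]big_nat_recr//= subSn// subnn big_nat1.
  rewrite big_nat_recr//= subnn addrA; congr (_ + _).
  rewrite -big_split/=; apply: eq_big_nat => j /andP[_ jN].
  by rewrite subSn ?(ltnW jN)// big_nat_recr.
rewrite mulr_sumr -sumrB; apply: eq_big_nat => j /andP[_ jN].
rewrite mulr_suml (big_cat_nat (leq0n (N - j)) (leq_subr j N))/=.
by rewrite addrAC subrr add0r.
Qed.

Lemma inv_fact_bin (F : numFieldType) (m j : nat) : (j <= m)%N ->
  (m`!%:R)^-1 * 'C(m, j)%:R = ((m - j)`!%:R)^-1 * (j`!%:R)^-1 :> F.
Proof.
move=> jm; have f0 k : k`!%:R != 0 :> F by rewrite pnatr_eq0 -lt0n fact_gt0.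
by rewrite -(bin_fact jm) !natrM; field; rewrite !f0 pnatr_eq0 -lt0n bin_gt0 jm.
Qed.

Lemma exp_coeffD (R : realType) (x y : R) (m : nat) :
  exp_coeff (x + y) m =
  \sum_(0 <= j < m.+1) exp_coeff x (m - j)%N * exp_coeff y j.
Proof.
rewrite /exp_coeff /= exprDn mulr_suml big_mkord; apply: eq_bigr => j _.
rewrite -mulr_natr -[LHS]mulrA [X in _ * X]mulrC (inv_fact_bin _ (leq_ord j)).
by rewrite mulrACA.
Qed.

(** * The entrywise maximum norm on matrices *)

Section MatrixNorm.
Context {R : realType}.

Lemma norm_coord_le (m n : nat) (M : 'M[R]_(m, n)) i j : `|M i j| <= `|M|.
Proof.
rewrite [leRHS]/Num.norm/= mx_normrE.
exact: (le_bigmax _ (fun ij => `|M ij.1 ij.2|) (i, j)).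
Qed.

Lemma mx_norm_le (m n : nat) (M : 'M[R]_(m, n)) (c : R) :
  0 <= c -> (forall i j, `|M i j| <= c) -> `|M| <= c.
Proof.
by move=> c0 Mc; rewrite [leLHS]/Num.norm/= mx_normrE; apply: bigmax_le.
Qed.

(** The norm is the largest absolute value of an entry, and an entry of the product is a sum of n
    products. Hence the factor n here, and n|X| in the later bounds. *)
Lemma norm_mulmx_le (m n p : nat) (A : 'M[R]_(m, n)) (B : 'M[R]_(n, p)) :
  `|A *m B| <= n%:R * (`|A| * `|B|).
Proof.
apply: mx_norm_le => [|i j]; first by rewrite !mulr_ge0.
rewrite mxE (le_trans (ler_norm_sum _ _ _))//.
rewrite mulr_natl -[X in _ *+ X]card_ord -sumr_const; apply: ler_sum => k _.
by rewrite normrM ler_pM ?norm_coord_le.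
Qed.

Lemma norm_exprmx_le (n : nat) (X : 'M[R]_n) (k : nat) :
  `|X ^+ k| <= (n%:R * `|X|) ^+ k.
Proof.
elim: k => [|k IH].
  rewrite !expr0; apply: mx_norm_le => // i j.
  by rewrite mxE; case: (i == j); rewrite ?normr1 ?normr0.
rewrite !exprS (le_trans (norm_mulmx_le _ _))// mulrA.
by rewrite ler_wpM2l ?mulr_ge0.
Qed.

Lemma cvg_mx_coord (m n : nat) (U : nat -> 'M[R]_(m, n)) (A : 'M[R]_(m, n)) i j :
  U @ \oo --> A -> (fun k => U k i j) @ \oo --> A i j.
Proof.
move=> UA; apply: (@cvg_comp _ _ _ U (fun M : 'M[R]_(m, n) => M i j) _ _ _ UA).
exact: coord_continuous.
Qed.

Lemma cvg_mulmx_coord (m n p : nat) (U : nat -> 'M[R]_(m, n))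
    (V : nat -> 'M[R]_(n, p)) (A : 'M[R]_(m, n)) (B : 'M[R]_(n, p)) i j :
  U @ \oo --> A -> V @ \oo --> B ->
  (fun k => (U k *m V k) i j) @ \oo --> (A *m B) i j.
Proof.
move=> UA VB; rewrite mxE; under eq_fun do rewrite mxE.
rewrite (_ : (fun k => _) = \sum_l (fun k => U k i l * V k l j)); last first.
  by apply/funext => k; rewrite fct_sumE.
apply: (big_ind2 (fun (u : nat -> R) (a : R) => u @ \oo --> a)).
- exact: cvg_cst.
- by move=> ? ? ? ?; exact: cvgD.
by move=> l _; apply: cvgM; exact: cvg_mx_coord.
Qed.

End MatrixNorm.

(** * The matrix exponential and commuting matrices *)

Section MatrixExponential.
Context {R : realType} {n : nat}.
Implicit Types X Y : 'M[R]_n.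

Local Notation expmx_coeff X := (fun m : nat => (m`!%:R)^-1 *: X ^+ m).

Lemma norm_expmx_coeff_le X m :
  `|expmx_coeff X m| <= exp_coeff (n%:R * `|X|) m.
Proof.
rewrite normrZ ger0_norm ?invr_ge0// /exp_coeff/= mulrC.
by rewrite ler_wpM2r ?invr_ge0 ?norm_exprmx_le.
Qed.

(** By the Cauchy criterion: each block of the series is dominated by the same block of the real
    exponential series at n|X|. *)
Lemma is_cvg_series_expmx X : cvgn (series (expmx_coeff X)).
Proof.
apply/cauchy_cvgP/cauchy_seriesP => e e0.
have /cauchy_cvgP/cauchy_seriesP/(_ e e0) := is_cvg_series_exp_coeff (n%:R * `|X|).
apply: filterS => p; apply: le_lt_trans.
rewrite (le_trans (ler_norm_sum _ _ _))//.
apply: le_trans (ler_norm _); apply: ler_sum => m _.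
exact: norm_expmx_coeff_le.
Qed.

Lemma cvg_expmx X : series (expmx_coeff X) @ \oo --> expmx X.
Proof. exact: is_cvg_series_expmx. Qed.

Lemma expmx_comm X Y : X *m Y = Y *m X -> expmx X *m Y = Y *m expmx X.
Proof.
move=> XY; apply/matrixP => i j.
have cvgY : (fun=> Y) @ \oo --> Y by exact: cvg_cst.
have XkY k : series (expmx_coeff X) k *m Y = Y *m series (expmx_coeff X) k.
  rewrite /series/= mulmx_suml mulmx_sumr; apply: eq_bigr => m _.
  rewrite -scalemxAl -scalemxAr; congr (_ *: _).
  by have /commr_sym/(commrX m)/commr_sym := XY.
have XY_cvg := @cvg_mulmx_coord _ _ _ _ _ _ _ _ i j (@cvg_expmx X) cvgY.
have YX_cvg := @cvg_mulmx_coord _ _ _ _ _ _ _ _ i j cvgY (@cvg_expmx X).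
rewrite (funext (fun k => congr1 (fun M => fun_of_matrix M i j) (XkY k))) in XY_cvg.
exact: (cvg_unique _ XY_cvg YX_cvg).
Qed.

Lemma expmx_coeffD X Y m : X *m Y = Y *m X ->
  expmx_coeff (X + Y) m =
  \sum_(0 <= j < m.+1) expmx_coeff X (m - j)%N *m expmx_coeff Y j.
Proof.
move=> XY; rewrite /= exprDn_comm// scaler_sumr big_mkord; apply: eq_bigr => j _.
rewrite -scalemxAl -scalemxAr scalerA -(inv_fact_bin _ (leq_ord j)).
by rewrite -scalerA scaler_nat.
Qed.

Lemma expmxD X Y : X *m Y = Y *m X -> expmx (X + Y) = expmx X *m expmx Y.
Proof.
move=> XY; apply/matrixP => i j.
pose x := n%:R * `|X|; pose y := n%:R * `|Y|.
pose E (Z : 'M[R]_n) := series (expmx_coeff Z); pose e z := series (@exp_coeff R z).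
have cvge z : e z @ \oo --> expR z by exact: is_cvg_series_exp_coeff.
(* [D] is the real Cauchy remainder at [x] and [y], times the factor n from [norm_mulmx_le]; it
   tends to 0 because e^x e^y = e^(x+y). *)
pose D N := n%:R * (e x N * e y N - e (x + y) N).
have D0 : D @ \oo --> 0.
  rewrite -[0](mulr0 n%:R) -[X in _ * X](subrr (expR (x + y))) [in X in X - _]expRD.
  by apply: cvgM; [exact: cvg_cst|apply: cvgB; [apply: cvgM|]].
have EB N : `|E X N *m E Y N - E (X + Y) N| <= D N.
  rewrite /E /series/= [X in `|X|](cauchy_product_partial _ (fun m => expmx_coeffD m XY)).
  rewrite /D /e /series/= (cauchy_product_partial _ (exp_coeffD x y)).
  rewrite mulr_sumr (le_trans (ler_norm_sum _ _ _))//; apply: ler_sum => k _.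
  rewrite mulr_sumr (le_trans (ler_norm_sum _ _ _))//; apply: ler_sum => l _.
  rewrite (le_trans (norm_mulmx_le _ _))// ler_wpM2l//.
  by rewrite ler_pM// norm_expmx_coeff_le.
have UV := @cvg_mulmx_coord _ _ _ _ _ _ _ _ i j (@cvg_expmx X) (@cvg_expmx Y).
have W := @cvg_mx_coord _ _ _ _ _ i j (@cvg_expmx (X + Y)).
have UVW := cvgB UV W.
have Z : (fun N => (E X N *m E Y N) i j - E (X + Y) N i j) @ \oo --> (0 : R).
  apply: (squeeze_cvgr (f := \- D) (h := D)) => //; last first.
    by rewrite -oppr0; exact: cvgN.
  apply: nearW => N; rewrite -ler_norml; apply: le_trans (EB N).
  by have := norm_coord_le (E X N *m E Y N - E (X + Y) N) i j; rewrite !mxE.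
by apply/esym/subr0_eq; exact: (cvg_unique _ (UVW _) Z).
Qed.

Lemma expmxZ_comm (x : R) X Y :
  X *m Y = Y *m X -> expmx (x *: X) *m Y = Y *m expmx (x *: X).
Proof. by move=> XY; apply: expmx_comm; rewrite -scalemxAl -scalemxAr XY. Qed.

Lemma expmxZD (x y : R) X :
  expmx ((x + y) *: X) = expmx (x *: X) *m expmx (y *: X).
Proof.
by rewrite scalerDl expmxD// -!scalemxAl -!scalemxAr !scalerA mulrC.
Qed.

End MatrixExponential.

(** * Closed forms of the Mittag-Leffler function and of the delayed terms *)

Lemma mittag_leffler_0 (R : realType) (n : nat) (alpha beta x : R) :
  mittag_leffler alpha beta (0 : 'M[R]_n) x =
  (x `^ (beta - 1) / Gamma beta) *: 1%:M.
Proof.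
rewrite /mittag_leffler -scalerA; apply: congr1.
(* Only the term m = 0 survives, so the partial sums are constant from index 1 on; the one of index
   0 is empty. *)
apply: (cvg_lim (@norm_hausdorff _ _)); apply: cvg_near_cst.
near=> m; rewrite /series/= -(prednK (_ : 0 < m)%N); last by near: m; exact: nbhs_infty_gt.
rewrite big_nat_recl//= big1 ?addr0 => [|i _].
  by rewrite mulr0 powRr0 mul0r add0r expr0 div1r.
by rewrite exprS mul0r scaler0.
Unshelve. all: by end_near. Qed.

Lemma exprmxZ (R : comPzRingType) (n : nat) (a : R) (A : 'M[R]_n) (m : nat) :
  (a *: A) ^+ m = a ^+ m *: A ^+ m.
Proof.
elim: m => [|m IH]; first by rewrite !expr0 scale1r.
by rewrite !exprS IH -mulmxE -scalemxAl -scalemxAr scalerA.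
Qed.

(** Gamma(m + 1) = m! gives the exponential coefficients; for x >= 0 the real power x^m agrees with
    the natural one. *)
Lemma mittag_leffler_11 (R : realType) (n : nat) (A : 'M[R]_n) (x : R) :
  0 <= x -> mittag_leffler 1 1 A x = expmx (x *: A).
Proof.
move=> x0; rewrite /mittag_leffler subrr powRr0 scale1r /expmx.
rewrite (_ : (fun m : nat => _) = (fun m => (m`!%:R)^-1 *: (x *: A) ^+ m))//.
apply/funext => m.
by rewrite mul1r mulr1 Gamma_nat powR_mulrn// exprmxZ scalerA mulrC.
Qed.

Lemma delayedML_term_0 (R : realType) (n : nat) (h alpha beta : R)
    (A1 : 'M[R]_n) (k : nat) (t sigma : R) :
  0 < h -> 0 < alpha -> 0 < beta -> 0 < sigma < t ->
  delayedML_term h alpha beta 0 A1 k t sigma =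
  (ln (t / sigma) `^ (k%:R * alpha + beta - 1) / Gamma (k%:R * alpha + beta))
    *: A1 ^+ k.
Proof.
move=> h0 alpha0 beta0; elim: k t sigma => [|k IH] t sigma /andP[s0 st].
  by rewrite /= mittag_leffler_0 mul0r add0r expr0.
pose b := k%:R * alpha + beta.
have b0 : 0 < b by rewrite ltr_wpDl// mulr_ge0// ltW.
apply/matrixP => i j; rewrite /= !mxE.
(* The constant collects the entry of A1^(k+1) and the denominators Gamma(alpha), Gamma(b) of the
   two factors; these cancel the numerator of the Beta value. *)
rewrite (@Rintegral_log_beta _ _ _ alpha b
    ((A1 ^+ k.+1) i j / (Gamma alpha * Gamma b))) ?s0//.
  have -> : alpha + b = k.+1%:R * alpha + beta by rewrite /b -natr1; ring.
  have G1 := lt0r_neq0 (Gamma_gt0 alpha0); have G2 := lt0r_neq0 (Gamma_gt0 b0).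
  rewrite -[X in _ * X = _]mulrA mulrA divfK; last by rewrite mulf_neq0.
  by rewrite mulrC [(Gamma _)^-1 * _]mulrC.
move=> r; rewrite in_itv/= => /andP[sr rt].
rewrite IH; last by rewrite divr_gt0//= ltr_pM2r ?invr_gt0.
rewrite mittag_leffler_0 -scalemxAl mul1mx -scalemxAr -scalemxAl !scalerA mxE.
rewrite -/b mulmxE -exprS.
(* Both arguments are divided by h, so their ratio is unchanged and the delay drops out. *)
have -> : r / h / (sigma / h) = r / sigma by rewrite invf_div mulrA divfK ?(lt0r_neq0 h0).
rewrite [in RHS]invfM.
have mulE (u v w x y z : R) :
  w * (x * v * (y * u)) * z = z * (u * v) * (y * x * w) by ring.
exact: mulE.
Qed.

Lemma delayedML_term_comm (R : realType) (n : nat) (h : R) (A0 A1 : 'M[R]_n)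
    (k : nat) (t sigma : R) :
  0 < h -> A0 *m A1 = A1 *m A0 -> 0 < sigma < t ->
  delayedML_term h 1 1 A0 A1 k t sigma =
  (ln (t / sigma) ^+ k / k`!%:R) *: (A1 ^+ k *m expmx (ln (t / sigma) *: A0)).
Proof.
move=> h0 A01; elim: k t sigma => [|k IH] t sigma /andP[s0 st].
  rewrite /= mittag_leffler_11; last by rewrite ln_ge0// ler_pdivlMr// mul1r ltW.
  by rewrite !expr0 fact0 divr1 scale1r mul1mx.
have t0 := lt_trans s0 st.
pose L := ln (t / sigma).
have L0 : 0 <= L by rewrite ln_ge0// ler_pdivlMr// mul1r ltW.
apply/matrixP => i j; rewrite /= !mxE.
(* With a = 1 the factor ln(t / r)^(a-1) is 1, and b = k + 1 accounts for ln(r / sigma)^k. The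
   merged exponential is independent of r and joins the constant. *)
rewrite (@Rintegral_log_beta _ _ _ 1 (k%:R + 1)
    ((A1 ^+ k.+1 *m expmx (L *: A0)) i j / k`!%:R)) ?s0 ?ltr_wpDl//; last first.
  move=> r; rewrite in_itv/= => /andP[sr rt]; have r0 := lt_trans s0 sr.
  have lntr : 0 <= ln (t / r) by rewrite ln_ge0// ler_pdivlMr// mul1r ltW.
  have lnrs : 0 <= ln (r / sigma) by rewrite ln_ge0// ler_pdivlMr// mul1r ltW.
  rewrite IH; last by rewrite divr_gt0//= ltr_pM2r ?invr_gt0.
  rewrite mittag_leffler_11//.
  have -> : r / h / (sigma / h) = r / sigma.
    by rewrite invf_div mulrA divfK ?(lt0r_neq0 h0).
  have -> : expmx (ln (t / r) *: A0) *m A1 *m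
      (ln (r / sigma) ^+ k / k`!%:R *: (A1 ^+ k *m expmx (ln (r / sigma) *: A0))) =
      ln (r / sigma) ^+ k / k`!%:R *: (A1 ^+ k.+1 *m expmx (L *: A0)).
    rewrite -scalemxAr; apply: congr1.
    have A01k : A0 *m A1 ^+ k = A1 ^+ k *m A0 by exact: (commrX k A01).
    have -> : L = ln (t / r) + ln (r / sigma).
      by rewrite /L !ln_div//; ring.
    rewrite (expmxZ_comm _ A01) mulmxA -(mulmxA A1) (expmxZ_comm _ A01k).
    by rewrite exprS -mulmxE expmxZD !mulmxA.
  rewrite !mxE subrr powRr0 mul1r addrK powR_mulrn//.
  have mulE (u v w x : R) : w * (x * v * u) = u * v * (x * w) by ring.
  exact: mulE.
rewrite !mxE Gamma1 mul1r GammaS ?ltr_wpDl// Gamma_nat.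
have -> : 1 + (k%:R + 1) - 1 = k.+1%:R :> R by rewrite -natr1; ring.
rewrite powR_mulrn// -/L natr1 factS natrM invfM.
set M := \sum_(_ < n) _.
have mulE (u v l m : R) : u != 0 ->
    m / u * (u * (v / u) * l) = l * (v / u) * m by move=> u0; field.
by apply: mulE; rewrite pnatr_eq0 -lt0n fact_gt0.
Qed.

Lemma expmx0 (R : realType) (n : nat) : expmx (0 : 'M[R]_n) = 1%:M.
Proof.
by rewrite -(scaler0 _ 0) -mittag_leffler_11// mittag_leffler_0 subrr powRr0
  Gamma1 divr1 scale1r.
Qed.

(** Taken at x = - ln h, this computes the powers of A1 e^(-A0 ln h) in the delayed exponential. *)
Lemma exprmx_mul_expmxZ (R : realType) (n : nat) (A B : 'M[R]_n) (x : R) (j : nat) :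
  A *m B = B *m A ->
  (B *m expmx (x *: A)) ^+ j = B ^+ j *m expmx ((j%:R * x) *: A).
Proof.
move=> AB; elim: j => [|j IH]; first by rewrite mul0r scale0r expmx0 !expr0 mul1mx.
have ABj : A *m B ^+ j = B ^+ j *m A by exact: (commrX j AB).
rewrite exprS IH -mulmxE mulmxA -(mulmxA B) (expmxZ_comm _ ABj).
by rewrite -mulmxA exprS -mulmxE -!mulmxA -expmxZD -natr1 mulrDl mul1r addrC.
Qed.

(** * Uniqueness of the indices selected by [xget] *)

(** Two windows containing t give h^k < h^(j+1) and h^j < h^(k+1), hence j = k since h > 1. *)
Lemma delay_index_eq (R : realType) (h t s : R) (k : nat) :
  1 < h -> 0 < s -> s * h ^+ k < t <= s * h ^+ k.+1 -> delay_index h t s = k.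
Proof.
move=> h1 s0 kP; apply: xget_unique => //= j jP.
move: kP jP => /andP[kt tk] /andP[jt tj].
have := lt_le_trans kt tj; have := lt_le_trans jt tk.
by rewrite !ltr_pM2l// !ltr_eXn2l// !ltnS => jk kj; apply/eqP; rewrite eqn_leq jk.
Qed.

Lemma delayedML2E (R : realType) (n : nat) (h alpha beta : R) (A : 'M[R]_n)
    (p : nat) (x : R) :
  1 < h -> h^-1 < expR x -> h ^ (p%:Z - 1) < expR x <= h ^+ p ->
  delayedML2 h alpha beta A x =
  \sum_(j < p.+1) ((x - (j%:R - 1) * ln h) `^ (j%:R * alpha + beta - 1)
    / Gamma (j%:R * alpha + beta)) *: A ^+ j.
Proof.
move=> h1 hx pP; have h0 := lt_trans ltr01 h1.
(* The exponent is -1 at k = 0; splitting off h^(-1) leaves natural exponents to compare. *)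
have hE (k : nat) : h ^ (k%:Z - 1) = h^-1 * h ^+ k.
  by rewrite expfzDr ?gt_eqF// exprN1 mulrC.
rewrite /delayedML2 leNgt hx /=; suff -> : xget 0%N
  [set p : nat | h ^ (p%:Z - 1) < expR x <= h ^+ p] = p by [].
apply: xget_unique => //= j jP.
move: pP jP; rewrite !hE => /andP[px xp] /andP[jx xj].
have := lt_le_trans px xj; have := lt_le_trans jx xp.
by rewrite !ltr_pdivrMl// -!exprS !ltr_eXn2l// !ltnS => jp pj; apply/eqP; rewrite eqn_leq jp.
Qed.

Lemma delayed_expE (R : realType) (n : nat) (h : R) (B : 'M[R]_n)
    (p : nat) (x : R) :
  1 < h -> - ln h < x -> (p%:R - 1) * ln h < x <= p%:R * ln h ->
  delayed_exp h B x =
  \sum_(j < p.+1) ((x - (j%:R - 1) * ln h) ^+ j / j`!%:R) *: B ^+ j.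
Proof.
move=> h1 hx pP; have lnh0 : 0 < ln h by exact: ln_gt0.
rewrite /delayed_exp leNgt hx /=; suff -> : xget 0%N
  [set p : nat | (p%:R - 1) * ln h < x <= p%:R * ln h] = p by [].
apply: xget_unique => //= j jP.
move: pP jP => /andP[px xp] /andP[jx xj].
have := lt_le_trans px xj; have := lt_le_trans jx xp.
rewrite !ltr_pM2r// !ltrBlDr !natr1 !ltr_nat !ltnS => jp pj.
by apply/eqP; rewrite eqn_leq jp.
Qed.

(** * Termwise comparison of the sums in the three special cases *)

Theorem lemma9 (R : realType) (n : nat) (hn : (0 < n)%N)
    (h alpha beta : R) (hh : 1 < h) (halpha : 0 < alpha) (hbeta : 0 < beta)
    (A0 A1 : 'M[R]_n) :
  (* (i) *)
  (A0 = 0 ->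
    forall (k : nat) (t : R),
      h ^ (k%:Z - 1) < t / h <= h ^+ k -> 1 < t ->
      delayedML h alpha beta A0 A1 t 1
      = delayedML2 h alpha beta A1 (ln (t / h)))
  /\
  (* (ii) *)
  (A1 = 0 ->
    forall t s : R, 0 < s -> s < t ->
      delayedML h alpha beta A0 A1 t s
      = mittag_leffler alpha beta A0 (ln (t / s))
      /\
      mittag_leffler alpha beta A0 (ln (t / s))
      = ln (t / s) `^ (beta - 1) *:
          limn (series (fun m : nat =>
            (ln (t / s) `^ (alpha * m%:R) / Gamma (m%:R * alpha + beta))
              *: A0 ^+ m)))
  /\
  (* (iii) *)
  (alpha = 1 -> beta = 1 -> A0 *m A1 = A1 *m A0 ->
    forall (s : R) (k : nat) (t : R), 0 < s ->
      s * h ^+ k < t <= s * h ^+ k.+1 ->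
      delayedML h alpha beta A0 A1 t s
      = expmx ((ln t - ln s) *: A0) *m
        delayed_exp h (A1 *m expmx (- (ln h *: A0))) (ln t - ln (s * h))).
Proof.
have h0 := lt_trans ltr01 hh.
have hk0 k : 0 < h ^+ k by rewrite exprn_gt0.
have le_hk k j : (k <= j)%N -> h ^+ k <= h ^+ j.
  by move=> kj; rewrite ler_eXn2l.
have ln_shk t s (k : nat) : 0 < t -> 0 < s ->
    ln (t / (s * h ^+ k)) = ln t - ln s - k%:R * ln h.
  by move=> t0 s0; rewrite ln_div ?posrE ?mulr_gt0// lnM ?posrE// lnXn// opprD addrA mulr_natl.
have delayedMLE t s k : 0 < s -> s * h ^+ k < t <= s * h ^+ k.+1 ->
    delayedML h alpha beta A0 A1 t s =
    \sum_(j < k.+1) delayedML_term h alpha beta A0 A1 j t (s * h ^+ j).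
  move=> s0 kP; rewrite /delayedML (delay_index_eq hh s0 kP).
  have st : s < t.
    by move: kP => /andP[+ _]; apply: le_lt_trans; rewrite ler_peMr// ?exprn_ege1// ltW.
  by rewrite ltNge (ltW st) gt_eqF.
split; [|split].
- move=> A00 k t kP t1; have t0 := lt_trans ltr01 t1.
  (* Multiplying the condition on t / h by h gives the window of t for s = 1 with the same k, so
     both sums have k + 1 terms. *)
  have kt : 1 * h ^+ k < t <= 1 * h ^+ k.+1.
    move: kP; rewrite !mul1r expfzDr ?gt_eqF// exprN1.
    by rewrite ltr_pM2r ?invr_gt0// ler_pdivrMr// -exprSr.
  have th0 : 0 < t / h by rewrite divr_gt0.
  rewrite (delayedMLE _ _ _ ltr01 kt) (@delayedML2E _ _ _ _ _ _ k) ?lnK ?posrE//.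
    apply: eq_bigr => j _; rewrite A00 delayedML_term_0//.
      by rewrite (ln_shk t 1 j)// ln_div ?posrE// ln1; congr (((_ `^ _) / _) *: _); ring.
    move: kt => /andP[kt _]; rewrite mulr_gt0//= (le_lt_trans _ kt)//.
    by rewrite !mul1r le_hk// -ltnS.
  by rewrite -[ltLHS]mul1r ltr_pM2r// invr_gt0.
- move=> A10 t s s0 st; split=> //.
  (* Each term beyond j = 0 is an integral whose integrand contains the factor A1 = 0. *)
  rewrite /delayedML ltNge (ltW st) gt_eqF//= big_ord_recl /= mulr1 big1 ?addr0// => j _.
  apply/matrixP => i l; rewrite !mxE /Rintegral integral0_eq// => r _.
  by rewrite A10 mulmx0 mul0mx scaler0 mxE.
- move=> a1 b1 A01 s k t s0 kP; have /andP[kt tk] := kP.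
  have t0 : 0 < t by rewrite (lt_trans _ kt)// mulr_gt0.
  have lnh0 : 0 < ln h by exact: ln_gt0.
  have lnt j : s * h ^+ j < t -> ln s + j%:R * ln h < ln t.
    move=> jt; rewrite -subr_gt0 opprD addrA -ln_shk// ln_gt0// ltr_pdivlMr ?mulr_gt0//.
    by rewrite mul1r.
  rewrite (delayedMLE _ _ _ s0 kP) (@delayed_expE _ _ _ _ k)//.
  + rewrite mulmx_sumr; apply: eq_bigr => j _.
    have jt : s * h ^+ j < t.
      by apply: le_lt_trans kt; rewrite ler_pM2l// le_hk// -ltnS.
    rewrite a1 b1 (delayedML_term_comm j h0 A01); last by rewrite mulr_gt0//=.
    (* The factor e^(-j A0 ln h) released by the j-th power combines with e^(A0 (ln t - ln s)) into
       e^(A0 ln(t / (s h^j))). *)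
    have EB : (A1 *m expmx (- (ln h *: A0))) ^+ j =
        A1 ^+ j *m expmx ((j%:R * - ln h) *: A0).
      by rewrite -scaleNr; exact: exprmx_mul_expmxZ.
    rewrite (ln_shk t s j t0 s0) EB -scalemxAr.
    have A01j : A0 *m A1 ^+ j = A1 ^+ j *m A0 by exact: (commrX j A01).
    rewrite mulmxA (expmxZ_comm _ A01j) -mulmxA -expmxZD.
    have -> : ln t - ln s + j%:R * - ln h = ln t - ln s - j%:R * ln h by ring.
    (* The h inside ln(s h) absorbs the shift in j - 1. *)
    have -> // : ln t - ln (s * h) - (j%:R - 1) * ln h = ln t - ln s - j%:R * ln h.
    by rewrite lnM ?posrE//; ring.
  (* The bound - ln h < ln t - ln(s h) is s < t in logarithms, which follows from s <= s h^k < t. *)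
  + have := lnt 0; rewrite expr0 mulr1 lnM ?posrE// => st.
    have {}st : ln s < ln t.
      rewrite -[ln s]addr0 -[X in _ + X](mul0r (ln h)); apply: st.
      by apply: le_lt_trans kt; rewrite ler_peMr ?exprn_ege1// ltW.
    by lra.
  + have {}kt := lnt k kt; rewrite lnM ?posrE//; apply/andP; split; first by lra.
    have : ln t <= ln (s * h ^+ k.+1) by rewrite ler_ln ?posrE// mulr_gt0.
    by rewrite lnM ?posrE// lnXn// mulrS -(mulr_natl (ln h)); lra.
Qed.
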